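(* For all integers $s \ge 3$ (the clique size) and $n\ge 2$, we have $r_3(K_s,P_n)< 2^{c_s(\log n)^{s-1}}$, where $c_s = 5^s s!$ and $\log$ is base $2$.
   Context: An ordered $k$-uniform hypergraph is a $k$-uniform hypergraph whose vertex set is $\{1,\dots,m\}$ with its natural order; a copy of an ordered hypergraph $H$ in an ordered hypergraph $G$ is an order-preserving embedding of the vertex set of $H$ sending edges to edges. For ordered $k$-uniform hypergraphs $G,H$, the ordered Ramsey number $r_k(G,H)$ is the minimum $N$ such that every red/blue coloring of the $k$-element subsets of $[N]=\{1,\dots,N\}$ contains a red copy of $G$ or a blue copy of $H$. $K_s = K_s^{(3)}$ denotes the complete $3$-uniform hypergraph on $s$ vertices. The monotone path $P_n=P_n^{(3)}$ is the ordered $3$-uniform hypergraph on vertex set $\{1,\dots,n\}$ whose edges are the $n-2$ triples $\{i,i+1,i+2\}$, $i=1,\dots,n-2$. *)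

(* Defs.v *)
From HB Require Import structures.
From mathcomp Require Import all_boot all_order all_algebra.
From mathcomp Require Import all_classical all_reals all_analysis.

Set Implicit Arguments.
Unset Strict Implicit.
Unset Printing Implicit Defensive.

Import Order.TTheory GRing.Theory Num.Theory.

(* Ordered k-uniform hypergraphs on m vertices; the ordered vertex set
   {1, ..., m} is represented by 'I_m, i.e. shifted to {0, ..., m - 1}. *)
Record ohypergraph (k m : nat) := OHypergraph {
  edges : {set {set 'I_m}};
  edges_uniform : forall e, e \in edges -> #|e| = k
}.

Definition has_copy (k m N : nat) (H : ohypergraph k m) (G : ohypergraph k N) :=
  exists f : 'I_m -> 'I_N,
    (forall x y : 'I_m, (x < y)%N -> (f x < f y)%N) /\
    (forall e : {set 'I_m}, e \in edges H -> [set f x | x in e] \in edges G).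

Lemma color_class_uniform (k N : nat) (chi : {set 'I_N} -> bool) (c : bool) e :
  e \in [set e : {set 'I_N} | (#|e| == k) && (chi e == c)] -> #|e| = k.
Proof. by rewrite inE => /andP[/eqP]. Qed.

(* The values of chi on sets that do not have exactly k elements are ignored. *)
Definition color_class (k N : nat) (chi : {set 'I_N} -> bool) (c : bool) :
  ohypergraph k N := OHypergraph (@color_class_uniform k N chi c).

Definition red : bool := true.
Definition blue : bool := false.

Definition ramsey_arrows (k mG mH : nat)
    (G : ohypergraph k mG) (H : ohypergraph k mH) (N : nat) : Prop :=
  forall chi : {set 'I_N} -> bool,
    has_copy G (color_class k chi red) \/ has_copy H (color_class k chi blue).

(* r is the ordered Ramsey number r_k(G, H), i.e. the minimum of all N with
   ramsey_arrows G H N. A relation is used so that existence of the minimum is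
   part of any claim about it. *)
Definition is_ramsey_number (k mG mH : nat)
    (G : ohypergraph k mG) (H : ohypergraph k mH) (r : nat) : Prop :=
  ramsey_arrows G H r /\ (forall N, ramsey_arrows G H N -> (r <= N)%N).

Lemma complete_uniform (k s : nat) e :
  e \in [set e : {set 'I_s} | #|e| == k] -> #|e| = k.
Proof. by rewrite inE => /eqP. Qed.

Definition complete_hypergraph (k s : nat) : ohypergraph k s :=
  OHypergraph (@complete_uniform k s).

Definition path_edges (n : nat) : {set {set 'I_n}} :=
  [set e : {set 'I_n} | [exists i : 'I_n, exists j : 'I_n, exists l : 'I_n,
     [&& j == i.+1 :> nat, l == i.+2 :> nat & e == [set i; j; l]]]].

Lemma path_uniform (n : nat) e : e \in path_edges n -> #|e| = 3.
Proof.
rewrite inE => /existsP[i /existsP[j /existsP[l /and3P[/eqP ij /eqP il /eqP ->]]]].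
have nij : i != j by rewrite -val_eqE /= ij ltn_eqF.
have nil : i != l by rewrite -val_eqE /= il ltn_eqF // ltnW.
have njl : j != l by rewrite -val_eqE /= ij il ltn_eqF.
rewrite cardsU cards1 cards2 nij /= (_ : _ :&: _ = finset.set0) ?cards0 //.
apply/setP => x; rewrite !inE; case: (eqVneq x l) => [->|]; last by rewrite andbF.
by rewrite eq_sym (negbTE nil) eq_sym (negbTE njl).
Qed.

Definition monotone_path (n : nat) : ohypergraph 3 n :=
  OHypergraph (@path_uniform n).

Definition log2 {R : realType} (x : R) : R := (ln x / ln 2)%R.

(* Main.v *)
Require Import Defs.
From HB Require Import structures.
From mathcomp Require Import all_boot all_order all_algebra.
From mathcomp Require Import all_classical all_reals all_analysis.
From mathcomp Require Import zify.

Set Implicit Arguments.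
Unset Strict Implicit.
Unset Printing Implicit Defensive.

Import Order.TTheory GRing.Theory Num.Theory.

(** Label a pair [u < v] by the length of a longest blue path ending in [u v].
    Labels are smaller than [n], and a triple [u < v < w] whose labels do not
    increase is red, so it is enough to find an [s]-set all of whose triples have
    this property ("good" set).

    Suppose that a vertex set [A] contains no good [j]-set with labels in
    [[a, b)]. Keep a middle interval [[x, y)] such that [A] has no good
    [(j-1)]-set with labels in [[a, x)] nor in [[y, b)]. If many pairs have labels
    in the middle, then many have labels in its upper half or in its lower half
    (cut at [z]). In the former case pass to the out-neighbourhood of a vertex
    through upper labels: a good [(j-1)]-set with labels at most [z] there would be
    extended by the vertex. In the latter case pass to an in-neighbourhood. Either
    way the middle is halved at the cost of a constant factor in [#|A|]. If
    instead many pairs have labels outside the middle, proceed there with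
    [j - 1] in place of [j]. As every pair has a label, this can only stop at a
    single vertex, and it stops after O((log n)^(s-2)) rounds. *)

(** * Good sets, labelled pairs and neighbourhoods *)

Section Labelling.

Variables (N : nat) (l : 'I_N -> 'I_N -> nat).
Implicit Types (A B C : {set 'I_N}) (S T : pred nat).

Definition label_range a b : pred nat := fun c => (a <= c < b)%N.

Definition good a b C :=
  (forall x y, x \in C -> y \in C -> x < y -> label_range a b (l x y)) /\
  (forall x y z, x \in C -> y \in C -> z \in C -> x < y -> y < z ->
     l y z <= l x y).

Definition good_free j a b A := forall C, C \subset A -> #|C| = j -> ~ good a b C.

Lemma free_sub j a b A B : B \subset A -> good_free j a b A -> good_free j a b B.
Proof. by move=> sBA fA C sCB; apply: fA; apply: fintype.subset_trans sBA. Qed.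

Lemma free_empty j a A : 1 < j -> good_free j a a A.
Proof.
move=> j1 C _ cC [gC _].
have /card_gt1P[x [y [xC yC]]] : 1 < #|C| by rewrite cC.
rewrite neq_ltn => /orP[] h; [have := gC _ _ xC yC h|have := gC _ _ yC xC h].
all: by rewrite /label_range; lia.
Qed.

Definition labelled_pairs B S :=
  [set p : 'I_N * 'I_N | [&& p.1 \in B, p.2 \in B, p.1 < p.2 & S (l p.1 p.2)]].

Definition npairs B S := #|labelled_pairs B S|.

Definition out_nbrs B S (v : 'I_N) := [set w in B | (v < w) && S (l v w)].
Definition in_nbrs B S (v : 'I_N) := [set w in B | (w < v) && S (l w v)].

Lemma out_nbrs_sub B S v : out_nbrs B S v \subset B.
Proof. by apply/fintype.subsetP => w; rewrite inE => /andP[]. Qed.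

Lemma in_nbrs_sub B S v : in_nbrs B S v \subset B.
Proof. by apply/fintype.subsetP => w; rewrite inE => /andP[]. Qed.

Lemma npairs_sub A B S : A \subset B -> npairs A S <= npairs B S.
Proof.
move=> sAB; apply/subset_leq_card/fintype.subsetP => p; rewrite !inE.
by case/and4P=> pA1 pA2 -> ->; rewrite !(fintype.subsetP sAB).
Qed.

Lemma npairs_union A S S1 S2 :
  (forall c, S c -> S1 c || S2 c) -> npairs A S <= npairs A S1 + npairs A S2.
Proof.
move=> sS; apply: leq_trans (leq_card_setU _ _).
apply/subset_leq_card/fintype.subsetP => p; rewrite !inE.
by case/and4P=> -> -> -> /sS.
Qed.

Lemma npairs_out B S : npairs B S = \sum_(v in B) #|out_nbrs B S v|.
Proof.
rewrite /npairs -sum1_card.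
under [RHS]eq_bigr => v _ do rewrite -sum1_card.
rewrite pair_big_dep /=; apply: eq_bigl => p; rewrite !inE.
by case: (p.1 \in B).
Qed.

Lemma npairs_in B S : npairs B S = \sum_(v in B) #|in_nbrs B S v|.
Proof.
rewrite /npairs -sum1_card.
under [RHS]eq_bigr => v _ do rewrite -sum1_card.
rewrite pair_big_dep /= (reindex (fun p : 'I_N * 'I_N => (p.2, p.1))) /=; last first.
  by exists (fun p => (p.2, p.1)) => -[].
by apply: eq_bigl => p; rewrite !inE; case: (p.1 \in B); rewrite ?andbF.
Qed.

(** [B * B] is covered by the labelled pairs, their reversals and the diagonal. *)
Lemma npairs_all B S : (forall x y : 'I_N, x < y -> S (l x y)) ->
  #|B| ^ 2 <= (npairs B S).*2 + #|B|.
Proof.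
move=> allS; rewrite -[#|B| ^ 2]/(#|B| * #|B|) -cardsX.
set D := [set (x, x) | x in B].
set Q := [set (p.2, p.1) | p in labelled_pairs B S].
have cD : #|D| <= #|B| by apply: leq_imset_card.
have cQ : #|Q| <= npairs B S by apply: leq_imset_card.
suff : finset.setX B B \subset labelled_pairs B S :|: Q :|: D.
  move/subset_leq_card => h; apply: leq_trans h _.
  apply: leq_trans (leq_card_setU _ _) _; apply: leq_add cD.
  apply: leq_trans (leq_card_setU _ _) _; rewrite -addnn.
  exact: leq_add.
apply/fintype.subsetP => -[x y]; rewrite !inE /= => /andP[xB yB].
case: (ltngtP x y) => [xy|yx|/val_inj ->]; rewrite ?xB ?yB /=.
  by rewrite allS.
  apply/orP; left; apply/imsetP; exists (y, x) => //.
  by rewrite inE /= xB yB yx allS.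
by apply/orP; right; apply/imsetP; exists y.
Qed.

Lemma out_dense B S M : #|B| ^ 2 < M * npairs B S ->
  exists2 v, v \in B & #|B| < M * #|out_nbrs B S v|.
Proof.
move=> h; apply/exists_inP; apply/contraLR: h; rewrite -leqNgt.
move/exists_inPn => h; rewrite npairs_out big_distrr /= -[#|B| ^ 2]/(#|B| * #|B|).
rewrite -sum_nat_const; apply: leq_sum => v vB.
by rewrite leqNgt h.
Qed.

Lemma in_dense B S M : #|B| ^ 2 < M * npairs B S ->
  exists2 v, v \in B & #|B| < M * #|in_nbrs B S v|.
Proof.
move=> h; apply/exists_inP; apply/contraLR: h; rewrite -leqNgt.
move/exists_inPn => h; rewrite npairs_in big_distrr /= -[#|B| ^ 2]/(#|B| * #|B|).
rewrite -sum_nat_const; apply: leq_sum => v vB.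
by rewrite leqNgt h.
Qed.

(* A vertex joined to C by labels at least as large as those in C extends C on
   the left. *)
Lemma free_out j a b z y v A : a <= z -> y <= b -> v \in A ->
  good_free j.+1 a b A -> good_free j a z.+1 (out_nbrs A (label_range z y) v).
Proof.
move=> az yb vA fA C sC cC [gC1 gC2].
have inC w : w \in C -> [/\ w \in A, v < w & label_range z y (l v w)].
  by move/(fintype.subsetP sC); rewrite inE => /and3P[].
have vC : v \notin C by apply/negP => /inC[_]; rewrite ltnn.
(* For [j = 0] the forbidden good set is the single vertex [v]. *)
case: j cC fA => [|j] cC fA.
  case: (fA [set v]); rewrite ?cards1 ?finset.sub1set //.
  split=> [x x'|x x' x'']; rewrite !inE => /eqP-> /eqP->; rewrite ?ltnn //.
(* Labels in [C] are at most [z]; by [z < y] they stay below [b]. *)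
have zy : z < y.
  have /card_gt0P[w /inC[_ _]] : 0 < #|C| by rewrite cC.
  by rewrite /label_range; lia.
case: (fA (v |: C)); last first.
- split=> [p q|p q r].
    rewrite !inE => /orP[/eqP->|pC] /orP[/eqP->|qC] pq.
    + by rewrite ltnn in pq.
    + by have [_ _] := inC _ qC; rewrite /label_range; lia.
    + by have [_ + _] := inC _ pC; lia.
    + by have := gC1 _ _ pC qC pq; rewrite /label_range; lia.
  rewrite !inE => pvC qvC rvC pq qr.
  have qC : q \in C.
    case/orP: qvC => // /eqP qv; case/orP: pvC => [/eqP pv|/inC[_ + _]].
      by rewrite pv qv ltnn in pq.
    by rewrite -qv; lia.
  have [_ vq lvq] := inC _ qC.
  have rC : r \in C by case/orP: rvC => // /eqP rv; rewrite rv in qr; lia.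
  case/orP: pvC => [/eqP->|pC]; last exact: gC2.
  by have := gC1 _ _ qC rC qr; move: lvq; rewrite /label_range; lia.
- by rewrite cardsU1 vC cC.
- by rewrite finset.subUset finset.sub1set vA; apply/fintype.subsetP => w /inC[].
Qed.

(** Mirror image of [free_out]: [v] extends [C] on the right, its labels being below [z] and those
    in [C] at least [z]. *)
Lemma free_in j a b x z v A : a <= x -> z <= b -> v \in A ->
  good_free j.+1 a b A -> good_free j z b (in_nbrs A (label_range x z) v).
Proof.
move=> ax zb vA fA C sC cC [gC1 gC2].
have inC w : w \in C -> [/\ w \in A, w < v & label_range x z (l w v)].
  by move/(fintype.subsetP sC); rewrite inE => /and3P[].
have vC : v \notin C by apply/negP => /inC[_]; rewrite ltnn.
case: (fA (v |: C)); last first.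
- split=> [p q|p q r].
    rewrite !inE => /orP[/eqP->|pC] /orP[/eqP->|qC] pq.
    + by rewrite ltnn in pq.
    + by have [_ + _] := inC _ qC; lia.
    + by have [_ _] := inC _ pC; rewrite /label_range; lia.
    + have := gC1 _ _ pC qC pq; have [_ _] := inC _ qC; rewrite /label_range; lia.
  rewrite !inE => pvC qvC rvC pq qr.
  have qC : q \in C.
    case/orP: qvC => // /eqP qv; case/orP: rvC => [/eqP rv|/inC[_ + _]].
      by rewrite rv qv ltnn in qr.
    by rewrite -qv; lia.
  have [_ vq lvq] := inC _ qC.
  have pC : p \in C by case/orP: pvC => // /eqP pv; rewrite pv in pq; lia.
  case/orP: rvC => [/eqP->|rC]; last exact: gC2.
  by have := gC1 _ _ pC qC pq; move: lvq; rewrite /label_range; lia.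
- by rewrite cardsU1 vC cC.
- by rewrite finset.subUset finset.sub1set vA; apply/fintype.subsetP => w /inC[].
Qed.

(** * Clearing dense label ranges round by round *)

Variable K : nat.

Definition dense_pairs e B S := e * #|B| ^ 2 < K * npairs B S.

(* [w] bounds the number of rounds in which the pairs with labels in [S] can be
   the dense ones; [e / K] is the density threshold. *)
Fixpoint clearable w e A S : Prop :=
  if w is w'.+1 then
    forall B, B \subset A -> dense_pairs e B S ->
      exists B', [/\ B' \subset B, #|B| <= K.*2 * #|B'| & clearable w' e B' S]
  else npairs A S = 0.

Lemma clear_sub w e A B S : B \subset A -> clearable w e A S -> clearable w e B S.
Proof.
case: w => [|w] sBA /=; first by move=> h; have := npairs_sub S sBA; lia.
by move=> h C sCB; apply: h; apply: fintype.subset_trans sBA.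
Qed.

Lemma clearS w e A S : clearable w e A S -> clearable w.+1 e A S.
Proof.
elim: w A => [|w IH] A.
  move=> h B sBA; rewrite /dense_pairs; have := npairs_sub S sBA.
  by rewrite (h : npairs A S = 0) leqn0 => /eqP->; rewrite muln0.
move=> h B sBA /(h B sBA)[B' [sB' cB' hB']].
by exists B'; split=> //; apply: IH.
Qed.

Lemma clear_leq w w' e A S : w <= w' -> clearable w e A S -> clearable w' e A S.
Proof.
move=> /subnKC<-; elim: (w' - w) => [|k IH] h; first by rewrite addn0.
by rewrite addnS; apply/clearS/IH.
Qed.

Lemma dense_union e1 e2 e B S S1 S2 : e1 + e2 <= e ->
  (forall c, S c -> S1 c || S2 c) ->
  dense_pairs e B S -> dense_pairs e1 B S1 \/ dense_pairs e2 B S2.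
Proof.
move=> he hS; rewrite /dense_pairs => h; apply/orP; rewrite -[_ || _]negbK negb_or -!leqNgt.
apply/negP => /andP[h1 h2].
have := leq_mul (leqnn K) (npairs_union B hS).
have := leq_mul he (leqnn (#|B| ^ 2)).
by rewrite mulnDl mulnDr; lia.
Qed.

(* Either the dense part lies in T, where the rank of T drops, or in [mid]. *)
Lemma clear_step w v e0 e A S T mid :
  e0 + 1 <= e -> (forall c, S c -> T c || mid c) ->
  (forall B, B \subset A -> dense_pairs 1 B mid ->
     exists B', [/\ B' \subset B, #|B| <= K.*2 * #|B'| & clearable v e B' S]) ->
  clearable w e0 A T -> clearable (w + v.+1) e A S.
Proof.
move=> he hS; elim: w A => [|w IH] A hmid hT B sBA
    /(dense_union he hS)[dT|/(hmid _ sBA)[B' [sB' cB' hB']]].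
- move: dT; rewrite /dense_pairs; have := npairs_sub T sBA.
  by rewrite (hT : npairs A T = 0) leqn0 => /eqP->; rewrite muln0.
- by exists B'.
- have [B' [sB' cB' hB']] := hT _ sBA dT; exists B'; split=> //.
  apply: IH hB' => C sC; apply: hmid.
  exact: fintype.subset_trans sC (fintype.subset_trans sB' sBA).
- exists B'; split=> //; change (clearable (w + v.+1) e B' S).
  by apply: clear_leq hB'; lia.
Qed.

(** A round for [S] is a round for [S1] or for [S2]; the other rank survives since [clearable]
    passes to subsets. Hence the ranks add. *)
Lemma clear_union w1 w2 e1 e2 e A S S1 S2 : e1 + e2 <= e ->
  (forall c, S c -> S1 c || S2 c) ->
  clearable w1 e1 A S1 -> clearable w2 e2 A S2 -> clearable (w1 + w2) e A S.
Proof.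
move=> he hS; have [t] := ubnP (w1 + w2).
elim: t w1 w2 A => // t IH w1 w2 A lt_t h1 h2.
suff h : forall B, B \subset A -> dense_pairs e B S ->
    exists B', [/\ B' \subset B, #|B| <= K.*2 * #|B'|,
      0 < w1 + w2 & clearable (w1 + w2).-1 e B' S].
  case Ew: (w1 + w2) => [|w] /=; last first.
    move=> B sBA dB; have [B' [? ? _]] := h B sBA dB.
    by rewrite Ew => ?; exists B'.
  have w10 : w1 = 0 by lia.
  have w20 : w2 = 0 by lia.
  move: h1 h2; rewrite w10 w20 /= => h1 h2.
  by have := npairs_union A hS; lia.
move=> B sBA /(dense_union he hS)[d1|d2].
- case: w1 h1 lt_t => [|w1] h1 lt_t.
    move: d1; rewrite /dense_pairs; have := npairs_sub S1 sBA.
    by rewrite (h1 : npairs A S1 = 0) leqn0 => /eqP->; rewrite muln0.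
  have [B' [sB' cB' hB']] := h1 _ sBA d1; exists B'; split=> //.
  apply: IH => //; apply: clear_sub h2.
  exact: fintype.subset_trans sB' sBA.
- case: w2 h2 lt_t => [|w2] h2 lt_t.
    move: d2; rewrite /dense_pairs; have := npairs_sub S2 sBA.
    by rewrite (h2 : npairs A S2 = 0) leqn0 => /eqP->; rewrite muln0.
  have [B' [sB' cB' hB']] := h2 _ sBA d2; exists B'; split=> //.
    by rewrite addnS.
  rewrite addnS; apply: IH => //; first by lia.
  apply: clear_sub h1; exact: fintype.subset_trans sB' sBA.
Qed.

(** While two vertices remain, at least [#|A| ^ 2 / 4] pairs are labelled, a density above [e / K].
    So rounds, each costing a factor [K.*2], go on down to a single vertex. *)
Lemma card_clear w e A S : 4 * e < K -> (forall x y : 'I_N, x < y -> S (l x y)) ->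
  clearable w e A S -> #|A| <= K.*2 ^ w.
Proof.
move=> eK allS; elim: w A => [|w IH] A h.
  have := npairs_all A allS; rewrite (h : npairs A S = 0) expn0; nia.
have [A1|A1] := leqP #|A| 1.
  by apply: leq_trans A1 _; rewrite expn_gt0; lia.
have [|B' [_ cB' hB']] := h A (subxx _).
  have h1 := npairs_all A allS.
  have h4 : #|A| ^ 2 <= 4 * npairs A S by nia.
  have p0 : 0 < npairs A S by nia.
  apply: leq_ltn_trans (leq_mul (leqnn e) h4) _.
  by rewrite mulnA (mulnC e) ltn_pmul2r.
apply: leq_trans cB' _; rewrite expnS leq_mul2l IH ?orbT //.
Qed.

(** * Recursion on the size of the forbidden good sets *)

Fixpoint steps m i := if i is i'.+1 then m.+1 * (steps m i').*2 + m else 0.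

(** In each of the [m.+1] stages between halvings the two outer ranges take [steps m i] rounds each;
    the halvings take [m] more. The thresholds add up as [(2 ^ i - 1) + (2 ^ i - 1) + 1 = 2 ^ i.+1 -
    1], the last 1 being for the middle. *)
Lemma clear_free m i a b A : b < a + 2 ^ m -> good_free i.+2 a b A ->
  clearable (steps m i) (2 ^ i).-1 A (label_range a b).
Proof.
elim: i a b A => [|i IH] a b A ab fA.
  apply/eqP; rewrite cards_eq0; apply/eqP/setP => -[x y]; rewrite !inE /=.
  apply/negP => /and4P[xA yA xy lxy].
  (* A pair with its label in the range is already a good 2-set. *)
  case: (fA [set x; y]).
  - by rewrite finset.subUset !finset.sub1set xA.
  - by rewrite cards2 neq_ltn xy.
  split=> [p q|p q r]; rewrite !inE.
    by move=> /orP[]/eqP-> /orP[]/eqP->; rewrite ?ltnn // => ?; lia.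
  by move=> /orP[]/eqP-> /orP[]/eqP-> /orP[]/eqP->; rewrite ?ltnn //; lia.
set W := steps m i; set e := (2 ^ i.+1).-1.
have ee : (2 ^ i).-1 + (2 ^ i).-1 + 1 <= e.
  have i0 : 0 < 2 ^ i by rewrite expn_gt0.
  by rewrite /e expnS; lia.
(* Here [k] halvings of the middle [[x, y)] remain; at the start the middle is all of [[a, b)]. *)
suff H k x y B : k <= m -> a <= x -> x <= y -> y <= b -> y < x + 2 ^ k ->
    B \subset A -> good_free i.+2 a x B -> good_free i.+2 y b B ->
    clearable (k.+1 * W.*2 + k) e B (label_range a b).
  have [ba|ab'] := leqP b a.
    apply: (@clear_leq 0); first by [].
    apply/eqP; rewrite cards_eq0; apply/eqP/setP => -[x y]; rewrite !inE /=.
    by apply/negP => /and4P[_ _ _]; rewrite /label_range; lia.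
  apply: (H m a b) => //; first exact: ltnW.
  - exact: free_empty.
  - exact: free_empty.
elim: k x y B => [|k IHk] x y B km ax xy yb yx sBA flo fhi.
  (* The middle is empty, so only the outer ranges are left. *)
  have Exy : y = x by rewrite expn0 in yx; lia.
  rewrite mul1n addn0 -addnn.
  apply: (@clear_union _ _ (2 ^ i).-1 (2 ^ i).-1 _ _ _ (label_range a x) (label_range y b)).
  - by lia.
  - by move=> c; rewrite /label_range; lia.
  - by apply: IH flo; lia.
  - by apply: IH fhi; lia.
have -> : k.+2 * W.*2 + k.+1 = W + W + (k.+1 * W.*2 + k).+1 by lia.
apply: (@clear_step _ _ ((2 ^ i).-1 + (2 ^ i).-1) _ _ _
          (fun c => label_range a x c || label_range y b c) (label_range x y)) => //.
- by move=> c; rewrite /label_range; lia.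
- move=> C sCB dC.
  have sCA := fintype.subset_trans sCB sBA.
  have fC := free_sub sCA fA.
  (* With this rounding the new middles [[x, z)] and [[z.+1, y)] both have fewer than [2 ^ k]
     labels; [z] leaves the upper one because [free_out] covers labels up to [z] inclusive. One half
     carries half of the middle pairs, whence the factor [K.*2]. *)
  pose z := x + (y - x)./2.
  have [dlo|dhi] : #|C| ^ 2 < K.*2 * npairs C (label_range x z) \/
                   #|C| ^ 2 < K.*2 * npairs C (label_range z y).
    have hu c : label_range x y c -> label_range x z c || label_range z y c by rewrite /label_range; lia.
    have := npairs_union C hu; move: dC; rewrite /dense_pairs mul1n.
    set p := #|C| ^ 2; set u := npairs _ _; set u1 := npairs _ _; set u2 := npairs _ _.
    move=> h1 h2; apply/orP; rewrite -[_ || _]negbK negb_or -!leqNgt.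
    by apply/negP => /andP[]; have := leq_mul (leqnn K) h2; rewrite mulnDr; lia.
  + have [v vC cv] := in_dense dlo.
    exists (in_nbrs C (label_range x z) v); split; last 1 first.
    * apply: (IHk x z) => //.
      - by lia.
      - by rewrite /z; lia.
      - by rewrite /z; lia.
      - by move: yx; rewrite /z expnS; lia.
      - exact: fintype.subset_trans (in_nbrs_sub _ _ _) sCA.
      - apply: free_sub flo; exact: fintype.subset_trans (in_nbrs_sub _ _ _) sCB.
      - by apply: (free_in ax _ vC fC); rewrite /z; lia.
    * exact: in_nbrs_sub.
    * exact: ltnW.
  + have [v vC cv] := out_dense dhi.
    have zy : z < y.
      have /card_gt0P[w] : 0 < #|out_nbrs C (label_range z y) v|.
        by rewrite lt0n; apply/eqP => E; rewrite E muln0 in cv.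
      by rewrite inE /label_range; lia.
    exists (out_nbrs C (label_range z y) v); split; last 1 first.
    * apply: (IHk z.+1 y) => //.
      - by lia.
      - by rewrite /z; lia.
      - by move: yx; rewrite /z expnS; lia.
      - exact: fintype.subset_trans (out_nbrs_sub _ _ _) sCA.
      - by apply: (free_out _ yb vC fC); rewrite /z; lia.
      - apply: free_sub fhi; exact: fintype.subset_trans (out_nbrs_sub _ _ _) sCB.
    * exact: out_nbrs_sub.
    * exact: ltnW.
- apply: (@clear_union _ _ (2 ^ i).-1 (2 ^ i).-1 _ _ _ (label_range a x) (label_range y b)) => //.
  - by apply: IH flo; lia.
  - by apply: IH fhi; lia.
Qed.

End Labelling.

Lemma exists_good N (l : 'I_N -> 'I_N -> nat) m n i :
  (forall x y : 'I_N, x < y -> l x y < n) -> n < 2 ^ m ->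
  (2 ^ i.+3) ^ steps m i < N ->
  exists2 C : {set 'I_N}, #|C| = i.+2 & good l 0 n C.
Proof.
move=> lm nm hN; apply: contrapT => nC.
have fA : good_free l i.+2 0 n [set: 'I_N].
  by move=> C _ cC gC; apply: nC; exists C.
have i0 : 0 < 2 ^ i by rewrite expn_gt0.
(* [K = 2 ^ i.+2] exceeds four times the threshold [2 ^ i - 1], and [K.*2 = 2 ^ i.+3]. *)
have := @card_clear N l (2 ^ i.+2) _ _ _ _ _ _ 
  (clear_free (2 ^ i.+2) (nm : n < 0 + 2 ^ m) fA).
rewrite cardsT card_ord -muln2 -expnSr => h.
suff : N <= (2 ^ i.+3) ^ steps m i by rewrite leqNgt hN.
apply: h; first by rewrite !expnS; lia.
by move=> x y xy; rewrite /label_range lm.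
Qed.

(** * Blue paths and the labelling they define *)

(* Says that some blue monotone path on [k.+2] vertices ends with [u], [v]. *)
Fixpoint blue_path N (chi : {set 'I_N} -> bool) k (u v : 'I_N) : bool :=
  if k is k'.+1 then
    [exists w : 'I_N,
       [&& w < u, chi [set w; u; v] == blue & blue_path chi k' w u]]
  else true.

Lemma blue_path_leq N (chi : {set 'I_N} -> bool) j k u v :
  j <= k -> blue_path chi k u v -> blue_path chi j u v.
Proof.
elim: j k u v => // j IH [|k] u v // jk /existsP[w /and3P[wu b p]].
apply/existsP; exists w; rewrite wu b; apply: IH jk p.
Qed.

Lemma blue_path_vertices N (chi : {set 'I_N} -> bool) k (u v : 'I_N) :
  u < v -> blue_path chi k u v ->
  exists g : nat -> 'I_N,
    [/\ g k = u, g k.+1 = v, forall i, i <= k -> g i < g i.+1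
      & forall i, i < k -> chi [set g i; g i.+1; g i.+2] = blue].
Proof.
elim: k u v => [|k IH] u v uv.
  by move=> _; exists (fun i => if i is 0 then u else v); split=> // -[].
case/existsP=> w /and3P[wu /eqP b /(IH _ _ wu)[g [gk gk1 gi gb]]].
exists (fun i => if i <= k.+1 then g i else v); rewrite leqnn ltnn; split=> //.
- move=> i; case: (ltngtP i k.+1) => // [ik _|-> _]; last by rewrite gk1.
  exact: gi.
- move=> i ik1; have [->|ik] : i = k \/ i < k by lia.
    by rewrite leqnSn leqnn ltnn gk gk1.
  have [-> -> ->] : [/\ i <= k.+1, i.+1 <= k.+1 & i.+2 <= k.+1] by split; lia.
  exact: gb.
Qed.

Lemma card_ordered3 N (x y z : 'I_N) : x < y -> y < z -> #|[set x; y; z]| = 3.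
Proof.
move=> xy yz; rewrite finset.setUC cardsU1 cards2 !inE -!val_eqE /=.
by do !case: eqP; lia.
Qed.

Lemma blue_path_copy N (chi : {set 'I_N} -> bool) k (u v : 'I_N) :
  u < v -> blue_path chi k u v ->
  has_copy (monotone_path k.+2) (color_class 3 chi blue).
Proof.
move=> uv /(blue_path_vertices uv)[g [_ _ gi gb]].
exists (fun i : 'I_k.+2 => g i); split.
  move=> x y; case: y => y yk /=; elim: y yk => // y IH yk.
  rewrite ltnS leq_eqVlt => /predU1P[->|xy]; first by apply: gi; lia.
  by apply: ltn_trans (IH _ xy) (gi _ _); lia.
move=> e; rewrite inE => /existsP[i /existsP[j /existsP[h]]].
case/and3P=> /eqP ij /eqP ih /eqP->.
have ik : i < k by have := ltn_ord h; lia.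
rewrite !imsetU !imset_set1 ij ih inE gb // eqxx andbT.
by rewrite card_ordered3 //; apply: gi; lia.
Qed.

(** If [u v w] is blue, a longest blue path ending in [u v] extends by [w], so the label of [v w] is
    larger. *)
Lemma blue_path_labelling N (chi : {set 'I_N} -> bool) n : 2 <= n ->
  ~ has_copy (monotone_path n) (color_class 3 chi blue) ->
  exists l : 'I_N -> 'I_N -> nat,
    (forall u v : 'I_N, u < v -> l u v < n) /\
    (forall u v w : 'I_N, u < v -> v < w -> l v w <= l u v ->
       chi [set u; v; w] = red).
Proof.
case: n => [|[|n]] // _ ncopy.
have nP (u v : 'I_N) : u < v -> ~~ blue_path chi n u v.
  by move=> uv; apply/negP => /(blue_path_copy uv).
(* Here [n] is already reduced by 2. The maximum is attained as [k = 0] always qualifies, and the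
   cap [n.+2] leaves room for [(l u v).+1]. *)
pose l u v := \max_(k < n.+2 | blue_path chi k u v) k.
have Pl u v : blue_path chi (l u v) u v.
  rewrite /l (@bigop.bigmax_eq_arg _ ord0) //.
  by case: arg_maxnP.
have ln (u v : 'I_N) : u < v -> l u v < n.
  move=> uv; rewrite ltnNge; apply/negP => nl.
  by case/negP: (nP _ _ uv); apply: blue_path_leq (Pl u v).
exists l; split=> [u v /ln|u v w uv vw]; first by lia.
apply: contraTeq => cb; rewrite -ltnNge.
have lt : (l u v).+1 < n.+2 by have := ln _ _ uv; lia.
apply: (@leq_bigmax_cond _ (fun k : 'I_n.+2 => blue_path chi k v w)
          (fun k => nat_of_ord k) (Ordinal lt)) => /=.
by apply/existsP; exists u; rewrite uv Pl andbT; case: (chi _) cb.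
Qed.

(** * From good sets to red cliques *)

Lemma ordered_enum_val N (C : {set 'I_N}) (i j : 'I_#|C|) :
  i < j -> enum_val i < enum_val j.
Proof.
(* [enum C] is a subsequence of the increasing enumeration of ['I_N]. *)
have st : sorted ltn (map val (enum C)).
  apply: (subseq_sorted ltn_trans _ (iota_ltn_sorted 0 N)).
  rewrite -val_enum_ord map_subseq //.
  by rewrite enumT /enum_mem filter_subseq.
move=> ij; have x0 := enum_val i.
have sz (k : 'I_#|C|) : k < size (enum C) by rewrite -cardE.
rewrite !(enum_val_nth x0) -!(nth_map x0 0 val) //.
by rewrite (sorted_ltn_nth ltn_trans) // inE size_map.
Qed.

Lemma ramsey_arrows_cliques_paths m n i N : 2 <= n -> n < 2 ^ m ->
  (2 ^ i.+3) ^ steps m i < N ->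
  ramsey_arrows (complete_hypergraph 3 i.+2) (monotone_path n) N.
Proof.
move=> n2 nm hN chi.
have [|nblue] := EM (has_copy (monotone_path n) (color_class 3 chi blue)).
  by right.
left; have [l [ln lred]] := blue_path_labelling n2 nblue.
have [C cC [_ gC]] := exists_good ln nm hN.
have ltf (x y : 'I_i.+2) : x < y ->
    enum_val (cast_ord (esym cC) x) < enum_val (cast_ord (esym cC) y).
  by move=> xy; apply: ordered_enum_val.
exists (fun x => enum_val (cast_ord (esym cC) x)); split=> // e.
set f := fun x : 'I_i.+2 => enum_val _.
have injf : injective f by move=> x y /enum_val_inj/cast_ord_inj.
have fC x : f x \in C by apply: enum_valP.
rewrite !inE => /eqP ce; rewrite card_imset // ce eqxx /=; apply/eqP.
have cE : #|f @: e| = 3 by rewrite card_imset.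
have sE : f @: e \subset C by apply/fintype.subsetP => _ /imsetP[x _ ->].
(* The triple is listed in increasing order, as [lred] requires. *)
pose v (k : 'I_3) := enum_val (cast_ord (esym cE) k).
have vE k : v k \in f @: e by apply: enum_valP.
have vC k : v k \in C := fintype.subsetP sE _ (vE k).
pose k0 : 'I_3 := ord0; pose k1 : 'I_3 := lift ord0 ord0; pose k2 : 'I_3 := ord_max.
have v01 : v k0 < v k1 by apply: ordered_enum_val.
have v12 : v k1 < v k2 by apply: ordered_enum_val.
have -> : f @: e = [set v k0; v k1; v k2].
  apply/esym/eqP; rewrite eqEcard cE card_ordered3 // leqnn andbT.
  by rewrite !finset.subUset !finset.sub1set !vE.
by apply: lred => //; apply: gC.
Qed.

(** * Numerical estimates *)

Lemma steps_bound m i : (steps m i).*2 < m.+1.*2 ^ i.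
Proof.
elim: i => // i; rewrite expnS /=.
(* Strictness gives [2 W + 1 <= X]; the slack [2 (m + 1)] absorbs the added [2 m]. *)
by move: (steps m i) (_ ^ i) => W X; nia.
Qed.

Lemma exponent_bound t i : 0 < t ->
  (i.+3 * steps t.+1 i).+1 < 5 ^ i.+2 * (i.+2)`! * t ^ i.
Proof.
move=> t0; have hW := steps_bound t.+1 i.
(* The base 6 comes from [t + 2 <= 3 t]. *)
have h6 : t.+2.*2 ^ i <= 6 ^ i * t ^ i.
  by rewrite -expnMn; case: i {hW} => // i; rewrite leq_exp2r //; lia.
have hi : i.+3 * 6 ^ i < 5 ^ i.+2 * (i.+2)`!.
  elim: i {hW h6} => // i IH.
  rewrite expnS [5 ^ _]expnS factS.
  have : i.+4 * 6 <= i.+3 * (5 * i.+3) by nia.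
  by move: (6 ^ i) (5 ^ i.+2) (_`!) IH => a b c; nia.
apply: (@leq_ltn_trans (i.+3 * (6 ^ i * t ^ i))).
  by rewrite ltn_pmul2l //; lia.
by rewrite mulnA ltn_pmul2r // expn_gt0 t0.
Qed.

(** * Passage to the real exponent *)

Local Open Scope ring_scope.

Lemma trunc_log_le_log2 (R : realType) n : (0 < n)%N ->
  (trunc_log 2 n)%:R <= log2 n%:R :> R.
Proof.
move=> n0; have ln2 : 0 < ln 2 :> R by rewrite ln_gt0 // ltr1n.
rewrite /log2 ler_pdivlMr // mulr_natl -lnXn // ler_ln ?posrE ?exprn_gt0 ?ltr0n //.
by rewrite -natrX ler_nat trunc_logP.
Qed.

Theorem theorem1p2 (R : realType) (s n : nat) (hs : (3 <= s)%N) (hn : (2 <= n)%N) :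
  exists r : nat,
    is_ramsey_number (complete_hypergraph 3 s) (monotone_path n) r /\
    (r%:R : R) < 2 `^ (5 ^+ s * (s`!)%:R * log2 n%:R ^+ (s - 1)).
Proof.
case: s hs => [|[|i]] // _.
set t := trunc_log 2 n; set E := (i.+3 * steps t.+1 i)%N.
have t0 : (0 < t)%N by rewrite trunc_log_gt0.
have nt : (n < 2 ^ t.+1)%N by rewrite trunc_log_ltn.
have arr : ramsey_arrows (complete_hypergraph 3 i.+2) (monotone_path n) (2 ^ E).+1.
  by apply: (@ramsey_arrows_cliques_paths t.+1) => //; rewrite -expnM.
pose P r := `[< ramsey_arrows (complete_hypergraph 3 i.+2) (monotone_path n) r >].
have exP : exists r, P r by exists (2 ^ E).+1; apply/asboolP.
case: (ex_minnP exP) => r /asboolP Pr minr; exists r; split.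
  by split=> // N /asboolP; apply: minr.
(* Rounding up to a power of 2 costs the one unit that [exponent_bound] provides. *)
have rE : (r <= 2 ^ E.+1)%N.
  have rarr : (r <= (2 ^ E).+1)%N by apply: minr; apply/asboolP.
  apply: leq_trans rarr _.
  by rewrite expnS mul2n -addnn -addn1 leq_add2l expn_gt0.
have EX := exponent_bound i t0; rewrite -/E in EX.
set X := (5 ^ i.+2 * (i.+2)`! * t ^ i)%N in EX.
have tL := trunc_log_le_log2 R (ltnW hn); rewrite -/t in tL.
have t1 : 1 <= t%:R :> R by rewrite ler1n.
have XL : X%:R <= 5 ^+ i.+2 * (i.+2)`!%:R * log2 n%:R ^+ (i.+2 - 1) :> R.
  rewrite /X 2!natrM 2!natrX; apply: ler_wpM2l; first by rewrite mulr_ge0 ?exprn_ge0.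
  (* The rounds give the power [i] of [t]; it is raised to [i.+1] using [t >= 1]. *)
  rewrite subn1 /=; apply: (@le_trans _ _ (t%:R ^+ i.+1)).
    by rewrite ler_weXn2l.
  by rewrite lerXn2r ?nnegrE //; apply: le_trans tL.
apply: lt_le_trans (ler_powR _ XL); last by rewrite ler1n.
rewrite powR_mulrn // -natrX ltr_nat.
by apply: leq_ltn_trans rE _; rewrite ltn_exp2l.
Qed.
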